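(* Let $\mu,d\in\mathbb{C}$ with $|\mu|\leq 1$ and let $\Phi(z)=\mu z+d$ for $z\in\mathbb{C}$, such that $C_\Phi$ is bounded on $H_E(\xi)$. Then $C_\Phi$ is an isometry on $H_E(\xi)$ if and only if $|\mu|=1$ and $d=0$. Moreover, $C_\Phi$ is unitary on $H_E(\xi)$ if and only if $|\mu|=1$ and $d=0$.
   Context: Let $\xi=(\xi_n)_{n\ge 0}$ be a sequence of positive real numbers with $\lim_{n\to\infty}\xi_n^{1/n}=\infty$. $H_E(\xi)$ is the Hilbert space of entire functions $f(z)=\sum_{n=0}^\infty a_n z^n$ with $\|f\|^2=\sum_{n=0}^\infty |a_n|^2\xi_n^2<\infty$, with inner product $\langle f,g\rangle=\sum_{n=0}^\infty b_n\overline{c_n}\,\xi_n^2$ for $f=\sum b_nz^n$, $g=\sum c_nz^n$. For an entire function $\Phi$, the composition operator is $C_\Phi f=f\circ\Phi$. A bounded operator $S$ is an isometry if $\|Sx\|=\|x\|$ for all $x$ (equivalently $S^*S=I$), and unitary if $S^*S=SS^*=I$. *)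

(* Defs.v *)
From Stdlib Require Import Reals ClassicalEpsilon.
From Coquelicot Require Import Coquelicot.

Open Scope R_scope.

Definition entire (f : C -> C) : Prop :=
  forall z : C, @ex_derive C_AbsRing C_NormedModule f z.

(* f(z) = sum_n a_n z^n for every complex z *)
Definition power_series_expansion (f : C -> C) (a : nat -> C) : Prop :=
  forall z : C, @is_pseries C_AbsRing C_NormedModule a z (f z).

Definition HE (xi : nat -> R) (f : C -> C) : Prop :=
  entire f /\
  exists a : nat -> C,
    power_series_expansion f a /\
    ex_series (fun n => Cmod (a n) ^ 2 * xi n ^ 2).

(* The expansion is unique when it exists, so [epsilon] picks the Taylor
   coefficients; the value is junk when [f] has no expansion on C. *)
Definition coeff (f : C -> C) : nat -> C :=
  epsilon (inhabits (fun _ => RtoC 0)) (power_series_expansion f).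

(* Coquelicot's [Series] is real-valued only. *)
Definition CSeries (u : nat -> C) : C :=
  (Series (fun n => Re (u n)), Series (fun n => Im (u n))).

Definition HE_inner (xi : nat -> R) (f g : C -> C) : C :=
  CSeries (fun n => (coeff f n * Cconj (coeff g n) * RtoC (xi n ^ 2))%C).

Definition HE_norm (xi : nat -> R) (f : C -> C) : R :=
  sqrt (Series (fun n => Cmod (coeff f n) ^ 2 * xi n ^ 2)).

(* Operators on H_E(xi) are maps on all functions C -> C, of which only the
   restriction to [HE xi] matters. *)
Definition linear_on_HE (xi : nat -> R) (S : (C -> C) -> (C -> C)) : Prop :=
  forall (a b : C) (f g : C -> C), HE xi f -> HE xi g ->
    S (fun z => (a * f z + b * g z)%C) = (fun z => (a * S f z + b * S g z)%C).

Definition bounded_operator (xi : nat -> R) (S : (C -> C) -> (C -> C)) : Prop :=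
  (forall f, HE xi f -> HE xi (S f)) /\
  linear_on_HE xi S /\
  exists M : R, forall f, HE xi f -> HE_norm xi (S f) <= M * HE_norm xi f.

Definition isometry (xi : nat -> R) (S : (C -> C) -> (C -> C)) : Prop :=
  bounded_operator xi S /\
  forall f, HE xi f -> HE_norm xi (S f) = HE_norm xi f.

Definition is_adjoint (xi : nat -> R) (S T : (C -> C) -> (C -> C)) : Prop :=
  bounded_operator xi T /\
  forall f g, HE xi f -> HE xi g -> HE_inner xi (S f) g = HE_inner xi f (T g).

(* S* S = S S* = I; the adjoint is unique on [HE xi]. *)
Definition unitary (xi : nat -> R) (S : (C -> C) -> (C -> C)) : Prop :=
  bounded_operator xi S /\
  exists T, is_adjoint xi S T /\
    (forall f, HE xi f -> T (S f) = f) /\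
    (forall f, HE xi f -> S (T f) = f).

Definition comp_op (Phi : C -> C) (f : C -> C) : C -> C := fun z => f (Phi z).

(* Main.v *)
(** An isometry must preserve the norms of [z], [z + 1] and [z + i], which
    already forces [d = 0] and [|mu| = 1]. Conversely, composition with
    [z |-> mu z] multiplies the n-th Taylor coefficient by [mu^n], so for
    [|mu| = 1] it is unitary with adjoint the composition with
    [z |-> conj(mu) z]. *)
Require Import Defs.
From Stdlib Require Import Reals.
From Coquelicot Require Import Coquelicot.
From Stdlib Require Import Lra Lia FunctionalExtensionality ClassicalEpsilon.
Open Scope R_scope.

(** * Two-term series; complex series by components *)

Lemma is_series_two {K : AbsRing} {V : NormedModule K} (u : nat -> V) :
  (forall n, u (S (S n)) = zero) -> is_series u (plus (u 0%nat) (u 1%nat)).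
Proof.
intros u0.
assert (sums : forall n, sum_n u (S n) = plus (u 0%nat) (u 1%nat)).
{ induction n as [|n IH].
  - now rewrite sum_Sn, sum_O.
  - now rewrite sum_Sn, IH, u0, plus_zero_r. }
apply filterlim_ext_loc with (fun _ : nat => plus (u 0%nat) (u 1%nat)).
(* Partial sums are constant from index 1 on; the one of index 0 lacks [u 1]. *)
- exists 1%nat; intros [|n] hn; [lia|]; now rewrite sums.
- apply filterlim_const.
Qed.

Lemma fst_sum_n (u : nat -> C) n :
  fst (sum_n (u : nat -> C_NormedModule) n) = sum_n (fun k => fst (u k)) n.
Proof.
induction n as [|n IH]; [now rewrite !sum_O|].
rewrite !sum_Sn, <- IH; reflexivity.
Qed.

Lemma snd_sum_n (u : nat -> C) n :
  snd (sum_n (u : nat -> C_NormedModule) n) = sum_n (fun k => snd (u k)) n.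
Proof.
induction n as [|n IH]; [now rewrite !sum_O|].
rewrite !sum_Sn, <- IH; reflexivity.
Qed.

(** Balls of C are products of real balls, so a neighbourhood of [fst l] pulls back to one of
    [l]. *)
Lemma is_series_fst (u : nat -> C) (l : C) :
  @is_series C_AbsRing C_NormedModule u l -> is_series (fun n => fst (u n)) (fst l).
Proof.
intros H P [e He].
destruct (H (fun z => P (fst z))) as [N HN].
{ exists e; intros y [Hy _]; now apply He. }
exists N; intros n hn; rewrite <- fst_sum_n; now apply HN.
Qed.

Lemma is_series_snd (u : nat -> C) (l : C) :
  @is_series C_AbsRing C_NormedModule u l -> is_series (fun n => snd (u n)) (snd l).
Proof.
intros H P [e He].
destruct (H (fun z => P (snd z))) as [N HN].
{ exists e; intros y [_ Hy]; now apply He. }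
exists N; intros n hn; rewrite <- snd_sum_n; now apply HN.
Qed.

Lemma pow_n_Cpow (z : C) n : @pow_n C_AbsRing z n = (z ^ n)%C.
Proof. induction n as [|n IH]; [reflexivity|]; simpl; now rewrite IH. Qed.

(** * Uniqueness of Taylor coefficients *)

(** Convergence at 1 forces a radius of at least 1, and power series of positive radius that agree
    near 0 have equal coefficients. *)
Lemma real_coeff_unique (a b : nat -> R) (f : R -> R) :
  (forall x, is_series (fun n => a n * x ^ n) (f x)) ->
  (forall x, is_series (fun n => b n * x ^ n) (f x)) ->
  forall n, a n = b n.
Proof.
assert (radius : forall c : nat -> R,
  (forall x, is_series (fun n => c n * x ^ n) (f x)) -> Rbar_lt 0 (CV_radius c)).
{ intros c Hc; apply Rbar_lt_le_trans with (Finite 1); [simpl; lra|].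
  apply Rbar_not_lt_le; intros H.
  apply (CV_disk_outside c 1); [now rewrite Rabs_R1|].
  apply ex_series_lim_0; exists (f 1); apply Hc. }
intros Ha Hb n; apply PSeries_ext_recip; [now apply radius..|].
exists (mkposreal 1 Rlt_0_1); intros x _; unfold PSeries.
now rewrite (is_series_unique _ _ (Ha x)), (is_series_unique _ _ (Hb x)).
Qed.

(** Powers of a real [x] are real, so the components of [a n] separate. This reduces complex
    uniqueness to the real case. *)
Lemma expansion_real_axis f a : power_series_expansion f a -> forall x : R,
  is_series (fun n => fst (a n) * x ^ n) (fst (f (RtoC x))) /\
  is_series (fun n => snd (a n) * x ^ n) (snd (f (RtoC x))).
Proof.
intros H x; split.
- eapply is_series_ext; [|exact (is_series_fst _ _ (H (RtoC x)))].
  intros n; simpl; rewrite pow_n_Cpow, <- RtoC_pow.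
  unfold scal; simpl; unfold mult; simpl; ring.
- eapply is_series_ext; [|exact (is_series_snd _ _ (H (RtoC x)))].
  intros n; simpl; rewrite pow_n_Cpow, <- RtoC_pow.
  unfold scal; simpl; unfold mult; simpl; ring.
Qed.

Lemma expansion_unique f a b :
  power_series_expansion f a -> power_series_expansion f b -> forall n, a n = b n.
Proof.
intros Ha Hb n.
rewrite (surjective_pairing (a n)), (surjective_pairing (b n)); f_equal.
- apply (real_coeff_unique (fun k => fst (a k)) (fun k => fst (b k))
    (fun x => fst (f (RtoC x)))); intros x; now apply expansion_real_axis.
- apply (real_coeff_unique (fun k => snd (a k)) (fun k => snd (b k))
    (fun x => snd (f (RtoC x)))); intros x; now apply expansion_real_axis.
Qed.

(** Makes the [epsilon] in [coeff] computable: any explicit expansion determines its value. *)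
Lemma coeff_expansion f a : power_series_expansion f a -> forall n, coeff f n = a n.
Proof.
intros Ha; apply expansion_unique with f; trivial.
exact (epsilon_spec _ _ (ex_intro _ a Ha)).
Qed.

Lemma HE_coeff xi f : HE xi f -> power_series_expansion f (coeff f).
Proof. intros [_ [a [Ha _]]]; exact (epsilon_spec _ _ (ex_intro _ a Ha)). Qed.

Lemma HE_coeff_summable xi f : HE xi f ->
  ex_series (fun n => Cmod (coeff f n) ^ 2 * xi n ^ 2).
Proof.
intros [_ [a [Ha Hs]]]; eapply ex_series_ext; [|exact Hs].
intros n; simpl; now rewrite (coeff_expansion f a).
Qed.

(** * Affine test functions *)

Lemma ex_derive_affine (p q z : C) :
  @ex_derive C_AbsRing C_NormedModule (fun w => (p + q * w)%C) z.
Proof.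
apply (@ex_derive_plus C_AbsRing C_NormedModule (fun _ => p) (fun w => (q * w)%C)).
- apply ex_derive_const.
(* The variable becomes the scalar, the form that [is_derive_scal_l] differentiates. *)
- apply ex_derive_ext with (fun w : C_AbsRing => @scal C_AbsRing C_NormedModule w q).
  + intros w; apply Cmult_comm.
  + eexists; apply is_derive_scal_l, is_derive_id.
Qed.

Definition affine_coeff (p q : C) (n : nat) : C :=
  match n with 0%nat => p | 1%nat => q | _ => RtoC 0 end.

Lemma affine_expansion (p q : C) :
  power_series_expansion (fun z => (p + q * z)%C) (affine_coeff p q).
Proof.
intros z.
set (u := fun k : nat =>
  @scal C_AbsRing C_NormedModule (pow_n z k) (affine_coeff p q k)).
replace (p + q * z)%C with (@plus C_NormedModule (u 0%nat) (u 1%nat)).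
- apply is_series_two; intros n; apply (@scal_zero_r C_AbsRing C_NormedModule).
- change ((1 * p + (z * 1) * q)%C = (p + q * z)%C); ring.
Qed.

Lemma affine_norm_series xi (p q : C) :
  is_series (fun n => Cmod (affine_coeff p q n) ^ 2 * xi n ^ 2)
    (Cmod p ^ 2 * xi 0%nat ^ 2 + Cmod q ^ 2 * xi 1%nat ^ 2).
Proof.
apply (is_series_two (fun n => Cmod (affine_coeff p q n) ^ 2 * xi n ^ 2)).
intros n; simpl; rewrite Cmod_0; change (zero : R) with 0; ring.
Qed.

Lemma HE_affine xi (p q : C) : HE xi (fun z => (p + q * z)%C).
Proof.
split; [intros z; apply ex_derive_affine|].
exists (affine_coeff p q); split; [apply affine_expansion|].
eexists; apply affine_norm_series.
Qed.

(** Composition with an affine map keeps functions affine, so this formula evaluates both sides of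
    the isometry identity on them. *)
Lemma HE_norm_affine xi (p q : C) :
  HE_norm xi (fun z => (p + q * z)%C) =
  sqrt (Cmod p ^ 2 * xi 0%nat ^ 2 + Cmod q ^ 2 * xi 1%nat ^ 2).
Proof.
unfold HE_norm; f_equal.
rewrite <- (is_series_unique _ _ (affine_norm_series xi p q)).
apply Series_ext; intros n.
now rewrite (coeff_expansion _ _ (affine_expansion p q)).
Qed.

(** * Dilations and rotations *)

Lemma dilation_expansion (m : C) f a : power_series_expansion f a ->
  power_series_expansion (comp_op (fun z => (m * z)%C) f) (fun n => (m ^ n * a n)%C).
Proof.
intros H z; eapply is_series_ext; [|exact (H (m * z)%C)].
intros n; simpl; rewrite !pow_n_Cpow, Cpow_mult_l.
change ((m ^ n * z ^ n * a n)%C = (z ^ n * (m ^ n * a n))%C); ring.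
Qed.

Lemma coeff_dilation xi (m : C) f n : HE xi f ->
  coeff (comp_op (fun z => (m * z)%C) f) n = (m ^ n * coeff f n)%C.
Proof.
intros H.
apply (coeff_expansion _ (fun n => (m ^ n * coeff f n)%C)).
apply dilation_expansion, (HE_coeff _ _ H).
Qed.

Lemma Cmod_rotation (m c : C) n : Cmod m = 1 -> Cmod (m ^ n * c)%C = Cmod c.
Proof. intros H; rewrite Cmod_mult, Cmod_pow, H, pow1; ring. Qed.

Lemma HE_rotation xi (m : C) f : Cmod m = 1 -> HE xi f ->
  HE xi (comp_op (fun z => (m * z)%C) f).
Proof.
intros hm H; split.
- intros z; unfold comp_op; apply ex_derive_comp; [apply H|].
  (* The chain rule wants the inner map valued in the field as a module over itself. *)
  apply ex_derive_ext with
    (fun w : C_AbsRing => @scal C_AbsRing (AbsRing_NormedModule C_AbsRing) w m).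
  + intros w; apply Cmult_comm.
  + eexists; apply is_derive_scal_l, is_derive_id.
- exists (fun n => (m ^ n * coeff f n)%C); split.
  + apply dilation_expansion, (HE_coeff _ _ H).
  + eapply ex_series_ext; [|exact (HE_coeff_summable _ _ H)].
    intros n; simpl; now rewrite Cmod_rotation.
Qed.

Lemma HE_norm_rotation xi (m : C) f : Cmod m = 1 -> HE xi f ->
  HE_norm xi (comp_op (fun z => (m * z)%C) f) = HE_norm xi f.
Proof.
intros hm H; unfold HE_norm; f_equal; apply Series_ext; intros n.
now rewrite (coeff_dilation xi), Cmod_rotation.
Qed.

Lemma rotation_bounded xi (m : C) : Cmod m = 1 ->
  bounded_operator xi (comp_op (fun z => (m * z)%C)).
Proof.
intros hm; split; [intros f; now apply HE_rotation|].
split; [now intros a b f g _ _|].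
exists 1; intros f H; rewrite HE_norm_rotation; trivial; lra.
Qed.

Lemma rotation_isometry xi (m : C) : Cmod m = 1 ->
  isometry xi (comp_op (fun z => (m * z)%C)).
Proof.
intros hm; split; [now apply rotation_bounded|].
intros f H; now apply HE_norm_rotation.
Qed.

(** Termwise, [m ^ n] moves to the conjugated factor of the inner product as the conjugate of
    [(Cconj m) ^ n]. *)
Lemma rotation_adjoint xi (m : C) : Cmod m = 1 ->
  is_adjoint xi (comp_op (fun z => (m * z)%C)) (comp_op (fun z => (Cconj m * z)%C)).
Proof.
intros hm; split; [apply rotation_bounded; now rewrite Cmod_conj|].
intros f g Hf Hg; unfold HE_inner; f_equal.
apply functional_extensionality; intros n.
rewrite !(coeff_dilation xi), Cmult_conj, Cpow_conj, Cconj_conj; trivial; ring.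
Qed.

Lemma rotation_unitary xi (m : C) : Cmod m = 1 ->
  unitary xi (comp_op (fun z => (m * z)%C)).
Proof.
intros hm; split; [now apply rotation_bounded|].
exists (comp_op (fun z => (Cconj m * z)%C)); split; [now apply rotation_adjoint|].
assert (mm : (m * Cconj m)%C = RtoC 1).
{ rewrite <- Cmod2_conj, hm; f_equal; ring. }
split; intros f _; apply functional_extensionality; intros z; unfold comp_op;
  f_equal.
- now rewrite Cmult_assoc, mm, Cmult_1_l.
- now rewrite Cmult_assoc, (Cmult_comm _ m), mm, Cmult_1_l.
Qed.

(** * From unitary to isometric, and rigidity of affine isometries *)

Lemma HE_norm_inner xi f : HE_norm xi f = sqrt (Re (HE_inner xi f f)).
Proof.
unfold HE_norm, HE_inner, CSeries; cbn [Re fst]; f_equal; apply Series_ext; intros n.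
now rewrite <- Cmod2_conj, <- RtoC_mult.
Qed.

(** The inner product of [S f] with itself is that of [f] with [T (S f) = f]. *)
Lemma unitary_isometry xi S : unitary xi S -> isometry xi S.
Proof.
intros [Hb [T [[_ adj] [TS _]]]]; split; trivial.
intros f H.
rewrite !HE_norm_inner, adj, TS; trivial; now apply Hb.
Qed.

(* Comparing the norms of [z], [z + 1] and [z + i] with those of their images
   yields [|d|^2 = |d + 1|^2 - 1 = |d + i|^2 - 1], hence [d = 0]. *)
Lemma affine_isometry xi (mu d : C) : (forall n, 0 < xi n) ->
  isometry xi (comp_op (fun z => (mu * z + d)%C)) -> Cmod mu = 1 /\ d = RtoC 0.
Proof.
intros xi_pos [_ iso].
(* The test function [p + z] has image [(p + d) + mu z]; their norms are compared without the square
   roots. *)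
assert (norm_eq : forall p : C,
  Cmod (p + d)%C ^ 2 * xi 0%nat ^ 2 + Cmod mu ^ 2 * xi 1%nat ^ 2 =
  Cmod p ^ 2 * xi 0%nat ^ 2 + xi 1%nat ^ 2).
{ intros p.
  generalize (iso _ (HE_affine xi p (RtoC 1))).
  replace (comp_op (fun z => (mu * z + d)%C) (fun z => (p + 1 * z)%C))
    with (fun z => ((p + d) + mu * z)%C)
    by (apply functional_extensionality; intros z; unfold comp_op; ring).
  rewrite !HE_norm_affine, Cmod_1; intros E.
  apply sqrt_inj in E; [nra| |]; apply Rplus_le_le_0_compat;
    apply Rmult_le_pos; apply pow2_ge_0. }
assert (sq : forall c : C, Cmod c ^ 2 = fst c ^ 2 + snd c ^ 2).
{ intros c; unfold Cmod; rewrite pow2_sqrt; trivial.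
  apply Rplus_le_le_0_compat; apply pow2_ge_0. }
destruct d as [dr di].
(* The values 0, 1 and i of [p], written as pairs so that components compute. *)
assert (E0 := norm_eq (0, 0)); assert (E1 := norm_eq (1, 0)).
assert (Ei := norm_eq (0, 1)).
rewrite (sq (_ + _)%C), (sq (_, _)) in E0.
rewrite (sq (_ + _)%C), (sq (_, _)) in E1.
rewrite (sq (_ + _)%C), (sq (_, _)) in Ei.
simpl in E0, E1, Ei.
assert (pos0 := xi_pos 0%nat); assert (pos1 := xi_pos 1%nat).
(* [E1 - E0] leaves [2 * dr * xi 0 ^ 2 = 0], and [Ei - E0] the same for [di]. *)
assert (dr0 : dr = 0) by (apply (Rmult_eq_reg_r (xi 0%nat * xi 0%nat)); nra).
assert (di0 : di = 0) by (apply (Rmult_eq_reg_r (xi 0%nat * xi 0%nat)); nra).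
subst; split; [|reflexivity].
(* With [d = 0], [E0] reads [Cmod mu ^ 2 * xi 1 ^ 2 = xi 1 ^ 2]. *)
assert (M : Cmod mu * Cmod mu = 1)
  by (apply (Rmult_eq_reg_r (xi 1%nat * xi 1%nat)); nra).
generalize (Cmod_ge_0 mu); nra.
Qed.

Theorem theorem2p7 (xi : nat -> R)
  (xi_pos : forall n, 0 < xi n)
  (xi_lim : is_lim_seq (fun n => Rpower (xi n) (/ INR n)) p_infty)
  (mu d : C) (mu_le1 : Cmod mu <= 1)
  (Phi : C -> C) (PhiE : forall z : C, Phi z = (mu * z + d)%C)
  (bounded : bounded_operator xi (comp_op Phi)) :
  (isometry xi (comp_op Phi) <-> (Cmod mu = 1 /\ d = RtoC 0)) /\
  (unitary xi (comp_op Phi) <-> (Cmod mu = 1 /\ d = RtoC 0)).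
Proof.
(* Serves both equivalences, since a unitary operator is an isometry. *)
assert (isoE : isometry xi (comp_op Phi) -> Cmod mu = 1 /\ d = RtoC 0).
{ replace Phi with (fun z => (mu * z + d)%C)
    by (apply functional_extensionality; intros z; now rewrite PhiE).
  now apply affine_isometry. }
assert (rotE : d = RtoC 0 -> Phi = (fun z => (mu * z)%C)).
{ intros ->; apply functional_extensionality; intros z; rewrite PhiE; ring. }
split; split.
- exact isoE.
- intros [hm hd]; rewrite rotE; trivial; now apply rotation_isometry.
- intros H; now apply isoE, unitary_isometry.
- intros [hm hd]; rewrite rotE; trivial; now apply rotation_unitary.
Qed.
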